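(* Let $n \geq 1$ and $1 \leq r \leq s$ be integers. Let $\mathcal{A}$ be a non-empty family of subsets of $[n]=\{1,\dots,n\}$, each of size at most $r$, and let $\mathcal{B}$ be a non-empty family of subsets of $[n]$, each of size at most $s$, such that $A \cap B \neq \emptyset$ for every $A \in \mathcal{A}$ and every $B \in \mathcal{B}$. Then \[|\mathcal{A}| + |\mathcal{B}| \leq 1 + \sum_{i=1}^s \left({n \choose i} - {n-r \choose i} \right),\] and equality holds if $\mathcal{A} = \{[r]\}$ and $\mathcal{B} = \{B \subseteq [n] \colon |B| \leq s,\ B \cap [r] \neq \emptyset\}$.
   Context: For integers $m\ge 0$, $[m]=\{1,\dots,m\}$ (with $[0]=\emptyset$). Binomial coefficients ${a \choose i}$ with $a<i$ (in particular when $a \le 0 < i$) are $0$. *)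

(* Defs.v *)
From mathcomp Require Export all_boot.

Set Implicit Arguments.
Unset Strict Implicit.
Unset Printing Implicit Defensive.

(* [n] = {1, ..., n} is encoded by 'I_n, the ordinal i standing for the element
   i + 1; so [r] is the set of ordinals below r. For r > n the set below is all
   of [n]. *)
Definition initial_set (n r : nat) : {set 'I_n} := [set i : 'I_n | i < r].

Definition cross_intersecting (T : finType) (A B : {set {set T}}) : Prop :=
  forall X Y : {set T}, X \in A -> Y \in B -> X :&: Y != set0.

(* Main.v *)
(** The bound is [1 + M(n, r, s)], where [M(n, r, s)] counts the sets of size at
    most [s] meeting a fixed [r]-set; it is proved by induction on the size [n]
    of the ground set [V].

    If [r + s <= n], shift both families away from a point [v] of [V]. Two sets
    through [v] never cover [V], so by stability the links of [v] are again
    cross-intersecting, with parameters [(r - 1, s - 1)]; the deletions of [v]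
    are nonempty and cross-intersecting with parameters [(r, s)]. Induction
    applies to both pairs. When one link is empty, the other one consists of
    sets meeting a fixed set, and the exchange inequality
    [M(n, r + d, q) <= M(n, r, q + d)] for [q <= r] concludes.

    If [n < r + s <= 2n], complementation injects the members of [A] of size at
    least [n - s] into the sets of size in [[n - r, s]] that are not in [B]. The
    remaining members have sizes at most [n - s - 1] and [n - r - 1], and these
    parameters fall under the first case. *)

Require Import Defs.
From mathcomp Require Import zify.

Set Implicit Arguments.
Unset Strict Implicit.
Unset Printing Implicit Defensive.

(* Number of sets of size < b (not <= b) in an n-set that meet a fixed a-set. *)
Definition meet_count (n a b : nat) : nat :=
  \sum_(i < b) ('C(n, i) - 'C(n - a, i)).

(** * Binomial recurrences and inequalities for [meet_count] *)

Lemma leq_bin_addr (m i k : nat) : 'C(m, i) <= 'C(m + k, i + k).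
Proof.
elim: k => [|k IHk]; first by rewrite !addn0.
by rewrite !addnS binS (leq_trans IHk) ?leq_addl.
Qed.

Lemma meet_count_homo (n a a' b : nat) :
  a <= a' -> meet_count n a b <= meet_count n a' b.
Proof.
move=> le_aa'; apply: leq_sum => i _.
by apply/leq_sub2l/leq_bin2l/leq_sub2l.
Qed.

(** Pascal's rule: split by whether a point outside the [a]-set is chosen. *)
Lemma meet_countS (n a b : nat) : a <= n ->
  meet_count n.+1 a b.+1 = meet_count n a b.+1 + meet_count n a b.
Proof.
move=> le_an; rewrite /meet_count !(big_ord_recl b) /= !bin0 subnn !add0n.
rewrite -big_split /=; apply: eq_bigr => i _; rewrite /bump /= add1n.
rewrite subSn // !binS.
have := leq_bin2l i (leq_subr a n); have := leq_bin2l i.+1 (leq_subr a n).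
lia.
Qed.

(** The strict gain comes from singletons, which the bound [b.+2] always admits. It later absorbs
    the extra 1 of an inductive bound. *)
Lemma meet_count_ltS (n a b : nat) : a < n ->
  meet_count n a b.+2 < meet_count n a.+1 b.+2.
Proof.
move=> lt_an; rewrite /meet_count !(big_ord_recl b.+1) !(big_ord_recl b) /=.
rewrite !bin0 subnn !add0n !bin1 -addSn; apply: leq_add; first lia.
by apply: leq_sum => i _; apply/leq_sub2l/leq_bin2l/leq_sub2l.
Qed.

Lemma sum_bin_le (m q d : nat) : d < m ->
  \sum_(i < q) 'C(m - d.+1, i) + 'C(m, q + d.+1) <= 'C(m + q, q + d.+1).
Proof.
move=> lt_dm; elim: q => [|q IHq]; first by rewrite big_ord0 addn0.
rewrite big_ord_recr /= addSn (addnS m) binS.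
(* The new summand is at most ['C(m, q + d.+1)], exactly the extra term of the induction
   hypothesis. *)
have := leq_bin_addr (m - d.+1) q d.+1; rewrite subnK // => le_bin.
rewrite addnC leq_add ?leq_bin2l ?leq_addr //.
by apply: leq_trans IHq; rewrite leq_add2l.
Qed.

(** The sum counts the sets meeting the larger set only in its added point. *)
Lemma meet_count_shiftS (n a q : nat) : a < n ->
  meet_count n a.+1 q.+1 = meet_count n a q.+1 + \sum_(i < q) 'C(n - a.+1, i).
Proof.
move=> lt_an; rewrite /meet_count !(big_ord_recl q) /= !bin0 subnn !add0n.
rewrite -big_split /=; apply: eq_bigr => i _; rewrite /bump /= add1n.
have -> : n - a = (n - a.+1).+1 by lia.
have := leq_bin2l i.+1 (leq_subr a n).
have -> : n - a = (n - a.+1).+1 by lia.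
rewrite binS; lia.
Qed.

Lemma meet_count_exchange (n r q d : nat) : q <= r -> r + d <= n ->
  meet_count n (r + d) q.+1 <= meet_count n r (q + d).+1.
Proof.
move=> le_qr; elim: d => [|d IHd] le_rdn; first by rewrite !addn0.
rewrite !addnS meet_count_shiftS; last lia.
have {}IHd : meet_count n (r + d) q.+1 <= meet_count n r (q + d).+1 by apply: IHd; lia.
have -> : meet_count n r (q + d).+2 =
  meet_count n r (q + d).+1 + ('C(n, (q + d).+1) - 'C(n - r, (q + d).+1)).
  by rewrite /meet_count big_ord_recr.
(* Compare the two increments by [sum_bin_le] with [m = n - r]; [q <= r] gives [n - r + q <= n]. *)
apply: leq_add => //; have lt_dm : d < n - r by lia.
have := sum_bin_le q lt_dm; rewrite addnS.
have := @leq_bin2l (n - r + q) n (q + d).+1 ltac:(lia).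
have -> : n - r - d.+1 = n - (r + d).+1 by lia.
lia.
Qed.

(** Above size [n - r] every set meets the [r]-set; at size [n - r] exactly one does not, whence the
    successor. *)
Lemma meet_count_split (n r s : nat) : r <= n -> n < r + s.+1 ->
  meet_count n r (n - r) + \sum_(n - r <= i < s.+1) 'C(n, i)
    = (meet_count n r s.+1).+1.
Proof.
move=> le_rn lt_n; rewrite /meet_count.
rewrite -!(big_mkord xpredT (fun i => 'C(n, i) - 'C(n - r, i))).
rewrite (@big_cat_nat _ _ _ (n - r) 0 s.+1) //=; last lia.
rewrite -addnS; congr (_ + _).
have lt1 : n - r < s.+1 by lia.
rewrite !(big_ltn lt1) binn.
have -> : \sum_((n - r).+1 <= i < s.+1) ('C(n, i) - 'C(n - r, i)) =
          \sum_((n - r).+1 <= i < s.+1) 'C(n, i).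
  by apply: eq_big_nat => i /andP[lt_i _]; rewrite (bin_small lt_i) subn0.
have : 0 < 'C(n, n - r) by rewrite bin_gt0 leq_subr.
lia.
Qed.

Lemma meet_count_minr (n r s : nat) : meet_count n (minn r n) s = meet_count n r s.
Proof. by apply: eq_bigr => i _; congr (_ - 'C(_, _)); lia. Qed.

Lemma meet_count_mins (n r s : nat) :
  meet_count n r (minn s n).+1 = meet_count n r s.+1.
Proof.
case: (leqP s n) => // lt_ns; rewrite /meet_count.
rewrite -!(big_mkord xpredT (fun i => 'C(n, i) - 'C(n - r, i))).
rewrite [RHS](@big_cat_nat _ _ _ n.+1) //=; last lia.
rewrite [X in _ + X]big_nat_cond [X in _ + X]big1 ?addn0 // => i.
by rewrite andbT => /andP[lt_ni _]; rewrite bin_small.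
Qed.

Section SetFamilies.

Variable T : finType.
Implicit Types (V X Y Z : {set T}) (A B : {set {set T}}).

(** * Counting subsets by size and by intersection *)

Lemma card_sized_subsets V (a b : nat) :
  #|[set Z : {set T} | (Z \subset V) && (a <= #|Z| < b)]|
    = \sum_(a <= i < b) 'C(#|V|, i).
Proof.
elim: b => [|b IHb].
  rewrite big_geq //; apply/eqP; rewrite cards_eq0; apply/eqP/setP => Z.
  by rewrite !inE ltn0 !andbF.
case: (leqP a b) => [le_ab|lt_ba]; last first.
  rewrite big_geq //; apply/eqP; rewrite cards_eq0; apply/eqP/setP => Z.
  by rewrite !inE; apply/negP => /and3P[_]; lia.
rewrite big_nat_recr //= -IHb -cards_draws -cardsUI.
rewrite [_ :&: _](_ : _ = set0) ?cards0 ?addn0.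
  by apply: eq_card => Z; rewrite !inE; case: (Z \subset V) => //=; lia.
by apply/setP => Z; rewrite !inE; case: (Z \subset V) => //=; lia.
Qed.

Lemma card_meeting V X (b : nat) : X \subset V ->
  #|[set Z : {set T} | [&& Z \subset V, #|Z| < b & Z :&: X != set0]]|
    = meet_count #|V| #|X| b.
Proof.
move=> sXV; pose S (W : {set T}) := [set Z : {set T} | (Z \subset W) && (0 <= #|Z| < b)].
have -> : [set Z : {set T} | [&& Z \subset V, #|Z| < b & Z :&: X != set0]]
    = S V :\: S (V :\: X).
  apply/setP => Z; rewrite !inE subsetD -setI_eq0.
  by case: (Z \subset V); case: (#|Z| < b); case: (_ == _).
have cVX : #|V :\: X| = #|V| - #|X| by rewrite cardsD (setIidPr sXV).
have sS : S (V :\: X) \subset S V.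
  by apply/subsetP => Z; rewrite !inE subsetD => /andP[/andP[-> _] ->].
rewrite cardsD (setIidPr sS) !card_sized_subsets cVX /meet_count !big_mkord.
by rewrite sumnB // => i _; apply/leq_bin2l/leq_subr.
Qed.

Lemma card_meeting_le V X B (a b : nat) :
  X \subset V -> #|X| <= a ->
  (forall Y, Y \in B -> [/\ Y \subset V, #|Y| < b & X :&: Y != set0]) ->
  #|B| <= meet_count #|V| a b.
Proof.
move=> sXV leXa hB; apply: leq_trans (meet_count_homo _ _ leXa).
rewrite -card_meeting //; apply/subset_leq_card/subsetP => Y /hB[sYV ltY mY].
by rewrite inE sYV ltY setIC.
Qed.

(** * Shifting from [v] to [i] *)

Definition shift_set (i v : T) X : {set T} :=
  if (v \in X) && (i \notin X) then i |: (X :\ v) else X.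

(** A set stays put when its shift is already in [A]; this keeps the map injective on [A]. *)
Definition shift_in (i v : T) A X : {set T} :=
  if shift_set i v X \in A then X else shift_set i v X.

Definition shift_family (i v : T) A : {set {set T}} := shift_in i v A @: A.

Lemma shift_inP (i v : T) A X : X \in A ->
  (shift_in i v A X = X /\ shift_set i v X \in A) \/
  [/\ v \in X, i \notin X, i |: (X :\ v) \notin A & shift_in i v A X = i |: (X :\ v)].
Proof.
move=> XA; rewrite /shift_in; case: ifPn => [|]; first by left.
by rewrite /shift_set; case: ifPn => [/andP[]|]; [right | rewrite XA].
Qed.

Lemma unshift (i v : T) X : v \in X -> i \notin X -> v |: ((i |: (X :\ v)) :\ i) = X.
Proof.
move=> vX iX; rewrite setU1K ?setD1K //.
by rewrite !inE (negPf iX) andbF.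
Qed.

Lemma shift_in_inj (i v : T) A : {in A &, injective (shift_in i v A)}.
Proof.
move=> X Y XA YA.
have [[-> _]|[vX iX nX ->]] := shift_inP i v XA;
have [[-> _]|[vY iY nY ->]] := shift_inP i v YA => //.
- by move=> eX; rewrite -eX XA in nY.
- by move=> eY; rewrite eY YA in nX.
- by move=> e; rewrite -(unshift vX iX) e unshift.
Qed.

Lemma card_shift_family (i v : T) A : #|shift_family i v A| = #|A|.
Proof. exact/card_in_imset/shift_in_inj. Qed.

Lemma shift_family_bounded (i v : T) V A (r : nat) : i \in V ->
  (forall X, X \in A -> X \subset V /\ #|X| <= r) ->
  forall X, X \in shift_family i v A -> X \subset V /\ #|X| <= r.
Proof.
move=> iV hA _ /imsetP[X XA ->]; have [sXV leX] := hA X XA.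
have [[-> _]//|[vX iX _ ->]] := shift_inP i v XA; split.
  by rewrite subUset sub1set iV (subset_trans (subsetDl _ _)).
by rewrite cardsU1 !inE (negPf iX) andbF /=; rewrite (cardsD1 v X) vX in leX.
Qed.

(** The mixed case: [X] stays and [Y] moves. If [i] is not in [X], the shift of [X] lies in [A] and
    meets [Y] in a point other than [i] and [v], which survives in both sets. *)
Lemma shift_in_meet (i v : T) A B X Y : cross_intersecting A B ->
  X \in A -> shift_set i v X \in A -> Y \in B -> v \in Y -> i \notin Y ->
  X :&: (i |: (Y :\ v)) != set0.
Proof.
move=> hAB XA sXA YB vY iY.
case iX: (i \in X); first by apply/set0Pn; exists i; rewrite !inE iX eqxx.
have /set0Pn[k /setIP[kX kY]] := hAB _ _ sXA YB.
have neki : k != i by apply: contraTneq kY => ->.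
move: kX; rewrite /shift_set iX andbT; case: ifPn => [vX|nvX] kX.
  move: kX; rewrite !inE (negPf neki) => /andP[nekv kX].
  by apply/set0Pn; exists k; rewrite !inE kX nekv kY orbT.
have nekv : k != v by apply: contraNneq nvX => <-.
by apply/set0Pn; exists k; rewrite !inE kX nekv kY orbT.
Qed.

Lemma shift_family_cross (i v : T) A B : cross_intersecting A B ->
  cross_intersecting (shift_family i v A) (shift_family i v B).
Proof.
move=> hAB _ _ /imsetP[X XA ->] /imsetP[Y YB ->].
have hBA : cross_intersecting B A by move=> P Q PB QA; rewrite setIC hAB.
have [[-> sX]|[vX iX _ ->]] := shift_inP i v XA;
have [[-> sY]|[vY iY _ ->]] := shift_inP i v YB.
- exact: hAB.
- exact: shift_in_meet hAB XA sX YB vY iY.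
- by rewrite setIC; apply: shift_in_meet hBA YB sY XA vX iX.
- by apply/set0Pn; exists i; rewrite !inE eqxx.
Qed.

(** * Degrees and stability under shifting *)

Definition degree (v : T) A : nat := #|[set X in A | v \in X]|.

Definition shift_stable (v : T) V A : Prop :=
  forall i X, i \in V -> X \in A -> v \in X -> i \notin X -> i |: (X :\ v) \in A.

Lemma degree_shift_sub (i v : T) A : i != v ->
  [set X in shift_family i v A | v \in X] \subset [set X in A | v \in X].
Proof.
move=> neiv; apply/subsetP => Z; rewrite !inE => /andP[/imsetP[X XA ->]].
have [[-> _]|[vX iX _ ->]] := shift_inP i v XA; first by rewrite XA.
by rewrite !inE eqxx orbF eq_sym (negPf neiv).
Qed.

Lemma degree_shift_le (i v : T) A : i != v ->
  degree v (shift_family i v A) <= degree v A.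
Proof. by move=> neiv; apply/subset_leq_card/degree_shift_sub. Qed.

Lemma degree_shift_lt (i v : T) A X : X \in A -> v \in X -> i \notin X ->
  i |: (X :\ v) \notin A -> degree v (shift_family i v A) < degree v A.
Proof.
move=> XA vX iX nA; have neiv : i != v by apply: contraNneq iX => ->.
apply/proper_card/properP; split; first exact: degree_shift_sub.
(* [X] itself drops out: a preimage of [X] is either [X] unmoved, against [nA], or moved, so that
   [i] would be in [X]. *)
exists X; rewrite !inE ?XA ?vX // andbT; apply/imsetP => -[Y YA].
have [[-> sY]|[vY iY _ ->]] := shift_inP i v YA => eX.
  by move: sY nA; rewrite /shift_set -eX vX iX => ->.
by rewrite eX !inE eqxx in iX.
Qed.

Lemma stable_or_unstable (v : T) V A : shift_stable v V A \/
  exists i X, [/\ i \in V, X \in A, v \in X, i \notin X & i |: (X :\ v) \notin A].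
Proof.
case: (boolP [exists i, exists X : {set T},
   [&& i \in V, X \in A, v \in X, i \notin X & i |: (X :\ v) \notin A]]).
  by case/existsP=> i /existsP[X /and5P[]]; right; exists i, X.
move/existsPn => h; left=> i X iV XA vX iX; apply/negPn/negP => nA.
by move/existsPn: (h i) => /(_ X); rewrite iV XA vX iX nA.
Qed.

(** Both families are shifted together to stay cross-intersecting. The sum of their degrees at [v]
    drops whenever one of them is unstable, so the process ends. *)
Lemma exists_stable_pair (v : T) V A B (r s : nat) :
  (forall X, X \in A -> X \subset V /\ #|X| <= r) ->
  (forall Y, Y \in B -> Y \subset V /\ #|Y| <= s) ->
  cross_intersecting A B ->
  exists A' B' : {set {set T}},
    [/\ #|A'| = #|A| /\ #|B'| = #|B|,
        forall X, X \in A' -> X \subset V /\ #|X| <= r,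
        forall Y, Y \in B' -> Y \subset V /\ #|Y| <= s,
        cross_intersecting A' B' & shift_stable v V A' /\ shift_stable v V B'].
Proof.
have [w] := ubnP (degree v A + degree v B).
elim: w A B => // w IHw A B ltw hA hB hAB.
have step i : i \in V ->
    degree v (shift_family i v A) + degree v (shift_family i v B)
      < degree v A + degree v B ->
    exists A' B' : {set {set T}},
    [/\ #|A'| = #|A| /\ #|B'| = #|B|,
        forall X, X \in A' -> X \subset V /\ #|X| <= r,
        forall Y, Y \in B' -> Y \subset V /\ #|Y| <= s,
        cross_intersecting A' B' & shift_stable v V A' /\ shift_stable v V B'].
  move=> iV lt_deg.
  have [||||A' [B' [cc h1 h2 h3 h4]]] :=
    IHw (shift_family i v A) (shift_family i v B).
  - lia.
  - exact: shift_family_bounded.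
  - exact: shift_family_bounded.
  - exact: shift_family_cross.
  by exists A', B'; split=> //; rewrite !card_shift_family in cc.
have [stA|[i [X [iV XA vX iX nA]]]] := stable_or_unstable v V A; last first.
  apply: (step i iV); have neiv : i != v by apply: contraNneq iX => ->.
  have := degree_shift_lt XA vX iX nA; have := degree_shift_le B neiv; lia.
have [stB|[i [X [iV XB vX iX nB]]]] := stable_or_unstable v V B; last first.
  apply: (step i iV); have neiv : i != v by apply: contraNneq iX => ->.
  have := degree_shift_lt XB vX iX nB; have := degree_shift_le A neiv; lia.
by exists A, B.
Qed.

(** * Deletions and links at a point *)

Definition deletion (v : T) A : {set {set T}} := [set X in A | v \notin X].

Definition link (v : T) A : {set {set T}} :=
  [set X :\ v | X in [set X in A | v \in X]].

Lemma card_deletion_link (v : T) A : #|deletion v A| + #|link v A| = #|A|.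
Proof.
rewrite card_in_imset.
  rewrite -(cardsID [set X : {set T} | v \in X] A) addnC; congr (_ + _);
    by apply: eq_card => X; rewrite !inE // andbC.
move=> X Y; rewrite !inE => /andP[_ vX] /andP[_ vY] e.
by rewrite -(setD1K vX) e setD1K.
Qed.

Lemma deletion_bounded (v : T) V A (r : nat) :
  (forall X, X \in A -> X \subset V /\ #|X| <= r) ->
  forall X, X \in deletion v A -> X \subset V :\ v /\ #|X| <= r.
Proof. by move=> hA X; rewrite inE => /andP[/hA[sXV leX] vX]; rewrite subsetD1 sXV. Qed.

Lemma link_bounded (v : T) V A (r : nat) :
  (forall X, X \in A -> X \subset V /\ #|X| <= r) ->
  forall X, X \in link v A -> X \subset V :\ v /\ #|X| < r.
Proof.
move=> hA _ /imsetP[X /[!inE]/andP[/hA[sXV leX] vX] ->]; split; first exact: setSD.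
by rewrite (cardsD1 v X) vX in leX.
Qed.

Lemma deletion_nonempty (v : T) V A (r : nat) : r < #|V| ->
  (forall X, X \in A -> X \subset V /\ #|X| <= r) -> shift_stable v V A ->
  A != set0 -> deletion v A != set0.
Proof.
move=> ltrV hA stA /set0Pn[X XA]; have [sXV leX] := hA X XA.
case vX: (v \in X); last by apply/set0Pn; exists X; rewrite inE XA vX.
have /properP[_ [i iV iX]] : X \proper V by rewrite properEcard sXV; lia.
apply/set0Pn; exists (i |: (X :\ v)); rewrite inE stA //= !inE eqxx orbF.
by apply: contraNneq iX => <-.
Qed.

Lemma link_cross (v : T) V A B (r s : nat) : r + s <= #|V| ->
  (forall X, X \in A -> X \subset V /\ #|X| <= r) ->
  (forall Y, Y \in B -> Y \subset V /\ #|Y| <= s) ->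
  shift_stable v V A -> cross_intersecting A B ->
  cross_intersecting (link v A) (link v B).
Proof.
move=> leV hA hB stA hAB _ W /imsetP[X /[!inE]/andP[XA vX] ->].
move=> /imsetP[Y /[!inE]/andP[YB vY] ->].
have [sXV leX] := hA X XA; have [sYV leY] := hB Y YB.
(* Since [v] is shared, the union has at most [r + s - 1] points. Replacing [v] in [X] by a missed
   point [i] forces a common point other than [v]. *)
have : X :|: Y \proper V.
  rewrite properEcard subUset sXV sYV /=.
  have := cardsUI X Y.
  have : 0 < #|X :&: Y| by apply/card_gt0P; exists v; rewrite inE vX.
  lia.
case/properP=> _ [i iV]; rewrite inE negb_or => /andP[iX iY].
have /set0Pn[k] := hAB _ _ (stA i X iV XA vX iX) YB.
rewrite !inE => /andP[/orP[/eqP->|/andP[nekv kX]] kY]; first by rewrite kY in iY.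
by apply/set0Pn; exists k; rewrite !inE nekv kX.
Qed.

(** * The inductive bound when [r + s] is at most the ground set size *)

Definition sum_bound_at (m : nat) : Prop := forall V A B (r s : nat),
  #|V| = m -> r <= s -> A != set0 -> B != set0 ->
  (forall X, X \in A -> X \subset V /\ #|X| <= r) ->
  (forall Y, Y \in B -> Y \subset V /\ #|Y| <= s) ->
  cross_intersecting A B ->
  #|A| + #|B| <= (meet_count m r s.+1).+1.

Lemma cross_bound_gt0 V A B (r : nat) :
  A != set0 -> B != set0 ->
  (forall X, X \in A -> X \subset V /\ #|X| <= r) ->
  cross_intersecting A B -> 0 < r /\ 0 < #|V|.
Proof.
move=> /set0Pn[X XA] /set0Pn[Y YB] hA hAB; have [sXV leX] := hA X XA.
have := hAB _ _ XA YB; rewrite -card_gt0 => lt0.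
have := subset_leq_card (subsetIl X Y); have := subset_leq_card sXV; lia.
Qed.

Lemma sum_bound_large (m : nat) : sum_bound_at m -> forall V A B (r s : nat),
  #|V| = m.+1 -> r <= s -> r + s <= m.+1 -> A != set0 -> B != set0 ->
  (forall X, X \in A -> X \subset V /\ #|X| <= r) ->
  (forall Y, Y \in B -> Y \subset V /\ #|Y| <= s) ->
  cross_intersecting A B ->
  #|A| + #|B| <= (meet_count m.+1 r s.+1).+1.
Proof.
move=> IHm V A0 B0 r s cV lers leV nA0 nB0 hA0 hB0 hAB0.
have [r_gt0 V_gt0] := cross_bound_gt0 nA0 nB0 hA0 hAB0.
have /card_gt0P[v vV] := V_gt0.
have [A [B [[cA cB] hA hB hAB [stA stB]]]] := exists_stable_pair v hA0 hB0 hAB0.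
rewrite -cA -cB; have nA : A != set0 by rewrite -card_gt0 cA card_gt0.
have nB : B != set0 by rewrite -card_gt0 cB card_gt0.
have cW : #|V :\ v| = m by move: cV; rewrite (cardsD1 v V) vV; case.
have nAd : deletion v A != set0 by apply: (deletion_nonempty _ hA) => //; lia.
have nBd : deletion v B != set0 by apply: (deletion_nonempty _ hB) => //; lia.
have hAd := deletion_bounded (v := v) hA; have hBd := deletion_bounded (v := v) hB.
have hAl := link_bounded (v := v) hA; have hBl := link_bounded (v := v) hB.
have hd : #|deletion v A| + #|deletion v B| <= (meet_count m r s.+1).+1.
  apply: (IHm (V :\ v)) => // X Y; rewrite !inE => /andP[XA _] /andP[YB _].
  exact: hAB.
(* The deletions already use up the extra 1, so the links must do without it. *)
suff hl : #|link v A| + #|link v B| <= meet_count m r s.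
  rewrite -(card_deletion_link v A) -(card_deletion_link v B) meet_countS; lia.
case: (eqVneq (link v A) set0) => [->|nAl].
  rewrite cards0 add0n -cW; have /set0Pn[X XAd] := nAd.
  have [sXV leX] := hAd X XAd; apply: (card_meeting_le sXV leX).
  move=> _ /imsetP[Y /[!inE]/andP[YB vY] ->].
  have YvL : Y :\ v \in link v B by apply/imsetP; exists Y; rewrite // inE YB vY.
  have [sYV ltY] := hBl _ YvL; split=> //.
  move: XAd; rewrite inE => /andP[XA vX].
  have /set0Pn[k /setIP[kX kY]] := hAB _ _ XA YB.
  apply/set0Pn; exists k; rewrite !inE kX kY andbT /=.
  by apply: contraNneq vX => <-.
case: (eqVneq (link v B) set0) => [->|nBl].
  rewrite cards0 addn0.
  have le1 : #|link v A| <= meet_count #|V :\ v| s r.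
    have /set0Pn[Y YBd] := nBd.
    have [sYV leY] := hBd Y YBd; apply: (card_meeting_le sYV leY).
    move=> _ /imsetP[X /[!inE]/andP[XA vX] ->].
    have XvL : X :\ v \in link v A by apply/imsetP; exists X; rewrite // inE XA vX.
    have [sXV ltX] := hAl _ XvL; split=> //.
    move: YBd; rewrite inE => /andP[YB vY].
    have /set0Pn[k /setIP[kX kY]] := hAB _ _ XA YB.
    apply/set0Pn; exists k; rewrite !inE kX kY andbT /=.
    by apply: contraNneq vY => <-.
  rewrite (leq_trans le1) // cW.
  (* The roles of [r] and [s] are swapped in [le1]; the exchange turns [meet_count m s r] into
     [meet_count m r s]. *)
  have := @meet_count_exchange m r r.-1 (s - r) ltac:(lia) ltac:(lia).
  by rewrite prednK // subnKC // -addSn prednK // subnKC.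
have hABl := link_cross (V := V) (r := r) (s := s) ltac:(lia) hA hB stA hAB.
have hAl' X : X \in link v A -> X \subset V :\ v /\ #|X| <= r.-1.
  by move=> /hAl[-> ltX]; split=> //; lia.
have hBl' X : X \in link v B -> X \subset V :\ v /\ #|X| <= s.-1.
  by move=> /hBl[-> ltX]; split=> //; lia.
have [r1_gt0 _] := cross_bound_gt0 nAl nBl hAl' hABl.
have := IHm (V :\ v) _ _ r.-1 s.-1 cW ltac:(lia) nAl nBl hAl' hBl' hABl.
(* Nonempty links force [r >= 2], so raising [r.-1] to [r] absorbs the extra 1. *)
have := @meet_count_ltS m r.-1 s.-2 ltac:(lia).
have -> : r.-1.+1 = r by lia.
have -> : s.-2.+2 = s by lia.
have -> : s.-1.+1 = s by lia.
lia.
Qed.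

(** * Complementation when [r + s] exceeds the ground set size *)

(** The complement of a member of [A] is disjoint from it, hence not in [B]. Complements of the
    counted members of [A] have sizes in the same range as the counted members of [B]. *)
Lemma card_complementary_sizes V A B (r s : nat) :
  (forall X, X \in A -> X \subset V /\ #|X| <= r) ->
  (forall Y, Y \in B -> Y \subset V /\ #|Y| <= s) ->
  cross_intersecting A B ->
  #|[set X in A | #|V| - s <= #|X|]| + #|[set Y in B | #|V| - r <= #|Y|]|
    <= \sum_(#|V| - r <= i < s.+1) 'C(#|V|, i).
Proof.
move=> hA hB hAB; set A2 := [set X in A | _]; set B2 := [set Y in B | _].
pose cA := [set V :\: X | X in A2].
have -> : #|A2| = #|cA|.
  rewrite card_in_imset // => X Y; rewrite !inE => /andP[/hA[sX _] _].
  move=> /andP[/hA[sY _] _] e.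
  have VDK Z : Z \subset V -> V :\: (V :\: Z) = Z.
    by move=> sZ; rewrite setDDr setDv set0U (setIidPr sZ).
  by rewrite -(VDK X sX) e VDK.
rewrite -card_sized_subsets -cardsUI.
have -> : cA :&: B2 = set0.
  apply/setP => Z; rewrite in_set0; apply/negP => /setIP[/imsetP[X]].
  rewrite inE => /andP[XA _] ->; rewrite inE => /andP[YB _].
  by have := hAB _ _ XA YB; rewrite setIDA setIC -setIDA setDv setI0 eqxx.
rewrite cards0 addn0; apply/subset_leq_card/subsetP => Z /setUP[].
  case/imsetP=> X /setIdP[/hA[sX leX] geX] ->.
  rewrite inE subsetDl cardsD (setIidPr sX) /=.
  have := subset_leq_card sX; lia.
by rewrite !inE => /andP[/hB[-> leZ] ->].
Qed.

Lemma sum_bound_small V A B (r s : nat) :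
  (forall A' B' (r' s' : nat), r' <= s' -> r' + s' <= #|V| ->
     A' != set0 -> B' != set0 ->
     (forall X, X \in A' -> X \subset V /\ #|X| <= r') ->
     (forall Y, Y \in B' -> Y \subset V /\ #|Y| <= s') ->
     cross_intersecting A' B' ->
     #|A'| + #|B'| <= (meet_count #|V| r' s'.+1).+1) ->
  r <= s -> s <= #|V| -> #|V| < r + s ->
  A != set0 -> B != set0 ->
  (forall X, X \in A -> X \subset V /\ #|X| <= r) ->
  (forall Y, Y \in B -> Y \subset V /\ #|Y| <= s) ->
  cross_intersecting A B ->
  #|A| + #|B| <= (meet_count #|V| r s.+1).+1.
Proof.
move=> large lers lesV ltV nA nB hA hB hAB.
pose A1 := [set X in A | #|X| < #|V| - s].
pose B1 := [set Y in B | #|Y| < #|V| - r].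
have sp := card_complementary_sizes hA hB hAB.
have eA : #|A| = #|A1| + #|[set X in A | #|V| - s <= #|X|]|.
  rewrite -(cardsID [set X : {set T} | #|X| < #|V| - s] A); congr (_ + _);
    by apply: eq_card => X; rewrite !inE -?leqNgt // andbC.
have eB : #|B| = #|B1| + #|[set Y in B | #|V| - r <= #|Y|]|.
  rewrite -(cardsID [set X : {set T} | #|X| < #|V| - r] B); congr (_ + _);
    by apply: eq_card => X; rewrite !inE -?leqNgt // andbC.
(* By [meet_count_split], the large members account for the rest of the bound, including the extra
   1. *)
suff h1 : #|A1| + #|B1| <= meet_count #|V| r (#|V| - r).
  rewrite -meet_count_split; lia.
have hA1 X : X \in A1 -> [/\ X \in A, X \subset V & #|X| < #|V| - s].
  by rewrite inE => /andP[XA ->]; have [] := hA X XA.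
have hB1 Y : Y \in B1 -> [/\ Y \in B, Y \subset V & #|Y| < #|V| - r].
  by rewrite inE => /andP[YB ->]; have [] := hB Y YB.
case: (eqVneq A1 set0) => [->|nA1].
  rewrite cards0 add0n; have /set0Pn[X XA] := nA; have [sX leX] := hA X XA.
  by apply: (card_meeting_le sX leX) => Y /hB1[YB sY ltY]; split=> //; apply: hAB.
(* [X0] only certifies [#|V| - s > 0], so that the predecessors below are not truncated. *)
have [X0 /hA1[_ _ ltX0]] := set0Pn _ nA1.
case: (eqVneq B1 set0) => [->|nB1].
  rewrite cards0 addn0.
  have le1 : #|A1| <= meet_count #|V| s (#|V| - s).
    have /set0Pn[Y YB] := nB; have [sY leY] := hB Y YB.
    apply: (card_meeting_le sY leY) => X /hA1[XA sX ltX]; split=> //.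
    by rewrite setIC; apply: hAB.
  apply: (leq_trans le1).
  have := @meet_count_exchange #|V| r (#|V| - s).-1 (s - r) ltac:(lia) ltac:(lia).
  have -> : (#|V| - s).-1.+1 = #|V| - s by lia.
  have -> : ((#|V| - s).-1 + (s - r)).+1 = #|V| - r by lia.
  by have -> : r + (s - r) = s by lia.
have hA1' X : X \in A1 -> X \subset V /\ #|X| <= (#|V| - s).-1.
  by move=> /hA1[_ sX ltX]; split=> //; lia.
have hB1' Y : Y \in B1 -> Y \subset V /\ #|Y| <= (#|V| - r).-1.
  by move=> /hB1[_ sY ltY]; split=> //; lia.
have hAB1 : cross_intersecting A1 B1.
  by move=> X Y /hA1[XA _ _] /hB1[YB _ _]; apply: hAB.
have [q_gt0 _] := cross_bound_gt0 nA1 nB1 hA1' hAB1.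
(* As [#|V| < r + s], the new parameters sum to less than [#|V|], and [#|V| - s <= r] lets
   monotonicity finish. *)
have := large A1 B1 (#|V| - s).-1 (#|V| - r).-1 ltac:(lia) ltac:(lia) nA1 nB1 hA1' hB1' hAB1.
have := @meet_count_ltS #|V| (#|V| - s).-1 (#|V| - r).-2 ltac:(lia).
have -> : (#|V| - r).-2.+2 = #|V| - r by lia.
have -> : (#|V| - r).-1.+1 = #|V| - r by lia.
have := @meet_count_homo #|V| (#|V| - s).-1.+1 r (#|V| - r) ltac:(lia).
lia.
Qed.

(** * Assembling the induction and passing to ['I_n] *)

Lemma sum_bound (m : nat) : sum_bound_at m.
Proof.
elim: m => [|m IHm] V A B r s cV lers nA nB hA hB hAB.
  by have [_] := cross_bound_gt0 nA nB hA hAB; rewrite cV.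
(* Capping [r] and [s] at [#|V|] leaves the bound unchanged and secures [s <= #|V|] for the
   complementation case. *)
rewrite -meet_count_mins -meet_count_minr -cV.
have hA' X : X \in A -> X \subset V /\ #|X| <= minn r #|V|.
  by move=> /hA[sX leX]; split=> //; have := subset_leq_card sX; lia.
have hB' Y : Y \in B -> Y \subset V /\ #|Y| <= minn s #|V|.
  by move=> /hB[sY leY]; split=> //; have := subset_leq_card sY; lia.
case: (leqP (minn r #|V| + minn s #|V|) #|V|) => [le_V|lt_V].
  rewrite cV; apply: (sum_bound_large IHm cV) => //; rewrite -?cV //; lia.
apply: sum_bound_small => //; try lia.
move=> A1 B1 r1 s1 le1 le2 nA1 nB1 hA1 hB1 hAB1.
rewrite cV; apply: (sum_bound_large IHm cV) => //; lia.
Qed.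

End SetFamilies.

Lemma meet_count_nat1 (n r s : nat) :
  meet_count n r s.+1 = \sum_(1 <= i < s.+1) ('C(n, i) - 'C(n - r, i)).
Proof.
rewrite /meet_count -(big_mkord xpredT (fun i => 'C(n, i) - 'C(n - r, i))).
by rewrite big_ltn // !bin0 subnn.
Qed.

Lemma card_initial_set (n r : nat) : #|initial_set n r| = minn r n.
Proof.
rewrite -sum1dep_card -(big_mkord (fun i => i < r) (fun=> 1)) big_mkcond /=.
elim: n => [|n IHn]; first by rewrite big_geq // minn0.
by rewrite big_nat_recr //= IHn; case: ltnP; lia.
Qed.

Theorem theorem1 (n r s : nat) (hn : 1 <= n) (hr : 1 <= r) (hrs : r <= s)
    (A B : {set {set 'I_n}})
    (hA0 : A != set0) (hA : forall X : {set 'I_n}, X \in A -> #|X| <= r)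
    (hB0 : B != set0) (hB : forall Y : {set 'I_n}, Y \in B -> #|Y| <= s)
    (hAB : cross_intersecting A B) :
  #|A| + #|B| <= 1 + \sum_(1 <= i < s.+1) ('C(n, i) - 'C(n - r, i))
  /\ (A = [set initial_set n r] ->
      B = [set Y : {set 'I_n} | (#|Y| <= s) && (Y :&: initial_set n r != set0)] ->
      #|A| + #|B| = 1 + \sum_(1 <= i < s.+1) ('C(n, i) - 'C(n - r, i))).
Proof.
rewrite -meet_count_nat1; split=> [|-> ->].
  apply: (@sum_bound _ _ [set: 'I_n]) => //; first by rewrite cardsT card_ord.
    by move=> X /hA; rewrite subsetT.
  by move=> Y /hB; rewrite subsetT.
rewrite cards1; congr (_ + _).
have := card_meeting s.+1 (subsetT (initial_set n r)).
(* For [r > n] the initial set has only [n] points, with the same count. *)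
rewrite cardsT card_ord card_initial_set meet_count_minr => <-.
by apply: eq_card => Y; rewrite !inE subsetT ltnS.
Qed.
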